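(* Let $(\mathcal{A},\partial)$ be a super-commutative DGA over a field $\mathbf{k}$ for which either: (1) $\operatorname{char}\mathbf{k}\neq 2$, and the grading is taken in the group $\mathbb{Z}/2\mathbb{Z}$; or (2) $\operatorname{char}\mathbf{k}=2$, and the grading is arbitrary (i.e. in $\mathbb{Z}/\mu\mathbb{Z}$ for any integer $\mu$). Then the characteristic algebra $\mathcal{C}=\mathcal{A}/\mathcal{A}\partial(\mathcal{A})\mathcal{A}$ is trivial if and only if $(\mathcal{A},\partial)$ is acyclic. Moreover, in case (1), the commutative unital algebra $\mathcal{C}/\mathcal{C}^{\mathrm{odd}}$, where $\mathcal{C}^{\mathrm{odd}}\subset\mathcal{C}$ denotes the two-sided ideal generated by the elements of odd degree, is trivial if and only if $(\mathcal{A},\partial)$ is acyclic.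
   Context: A super-commutative DGA over $\mathbf{k}$ is a pair $(\mathcal{A},\partial)$ as follows. $\mathcal{A}$ is the quotient of the free associative unital $\mathbf{k}$-algebra on finitely many generators $a_1,\dots,a_m$, with degrees $|a_i|\in\mathbb{Z}/\mu\mathbb{Z}$, by the relations $a\cdot b=(-1)^{|a||b|}\,b\cdot a$ for homogeneous $a,b$ (in particular, odd elements square to zero if $\operatorname{char}\mathbf{k}\ne2$; if $\operatorname{char}\mathbf{k}=2$, $\mathcal{A}$ is the polynomial algebra). The degree of a monomial is the sum of the degrees of its factors, and scalars have degree $0$. The map $\partial:\mathcal{A}\to\mathcal{A}$ is $\mathbf{k}$-linear of degree $-1$, with $\partial^2=0$, $\partial|_{\mathbf{k}}=0$ and $\partial(\mathbf{a}\mathbf{b})=\partial(\mathbf{a})\mathbf{b}+(-1)^{|\mathbf{a}|}\mathbf{a}\,\partial(\mathbf{b})$ for monomials $\mathbf{a},\mathbf{b}$ (signs are immaterial in characteristic two). Each generator also has an action $\ell(a_i)\in\mathbb{R}_{>0}$, extended additively to monomials with $\ell(r)=0$ for $r\in\mathbf{k}\setminus\{0\}$, such that every monomial appearing in $\partial(a_i)$ with a non-zero coefficient has action strictly less than $\ell(a_i)$. Acyclic means $\ker\partial/\operatorname{im}\partial=0$. $\mathcal{A}\partial(\mathcal{A})\mathcal{A}$ is the two-sided ideal generated by all boundaries $\partial(y)$, $y\in\mathcal{A}$; $\mathcal{C}$ inherits the grading. A unital algebra is trivial if it is zero. *)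

(* Defs.v *)
From HB Require Import structures.
From mathcomp Require Import all_boot all_order all_algebra.
From mathcomp Require Import finmap boolp reals.
From mathcomp.multinomials Require Import monalg.

Set Implicit Arguments.
Unset Strict Implicit.
Unset Printing Implicit Defensive.

Import Order.TTheory GRing.Theory Num.Theory.

Local Open Scope ring_scope.
Local Open Scope quotient_scope.

(* [algType k] requires [1 != 0], whereas the quotients below may be zero.
   A [pzAlgType k] is an associative unital [k]-algebra, the zero algebra
   included, given by the central unit map [k -> A]. *)
HB.mixin Record isPzAlgebra (k : fieldType) A of GRing.PzRing A := {
  pz_in : k -> A;
  pz_in_zmod_morphism : zmod_morphism pz_in;
  pz_in_monoid_morphism : monoid_morphism pz_in;
  pz_in_central : forall (c : k) (x : A), pz_in c * x = x * pz_in c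
}.

#[short(type="pzAlgType")]
HB.structure Definition PzAlgebra (k : fieldType) :=
  {A of GRing.PzRing A & isPzAlgebra k A}.

HB.instance Definition _ (k : fieldType) (A : pzAlgType k) :=
  GRing.isZmodMorphism.Build k A (@pz_in k A) (@pz_in_zmod_morphism k A).
HB.instance Definition _ (k : fieldType) (A : pzAlgType k) :=
  GRing.isMonoidMorphism.Build k A (@pz_in k A) (@pz_in_monoid_morphism k A).

Definition two_sided_ideal (A : pzRingType) (I : A -> Prop) : Prop :=
  [/\ I 0,
      forall x y, I x -> I y -> I (x + y)
    & forall a b x, I x -> I (a * x * b)].

Definition ideal_gen (A : pzRingType) (S : A -> Prop) (x : A) : Prop :=
  forall I : A -> Prop,
    two_sided_ideal I -> (forall y, S y -> I y) -> I x.

Lemma ideal_gen_ideal (A : pzRingType) (S : A -> Prop) :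
  two_sided_ideal (ideal_gen S).
Proof.
split=> [I []//|x y Sx Sy I HI SI|a b x Sx I HI SI].
  by case: (HI) => _ ID _; apply: ID; [apply: Sx|apply: Sy].
by case: (HI) => _ _ IM; apply: IM; apply: Sx.
Qed.

Lemma ideal_gen_sub (A : pzRingType) (S : A -> Prop) (x : A) :
  S x -> ideal_gen S x.
Proof. by move=> Sx I _; apply. Qed.

Section Quotient.
Variables (k : fieldType) (A : pzAlgType k) (S : A -> Prop).

Let I := ideal_gen S.

Let I0 : I 0. Proof. by case: (ideal_gen_ideal S). Qed.
Let ID x y : I x -> I y -> I (x + y).
Proof. by case: (ideal_gen_ideal S) => _ + _; apply. Qed.
Let IM a b x : I x -> I (a * x * b).
Proof. by case: (ideal_gen_ideal S) => _ _; apply. Qed.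
Let IMl a x : I x -> I (a * x).
Proof. by move=> /(@IM a 1); rewrite mulr1. Qed.
Let IMr b x : I x -> I (x * b).
Proof. by move=> /(@IM 1 b); rewrite mul1r. Qed.
Let IN x : I x -> I (- x).
Proof. by move=> /(@IMl (-1)); rewrite mulN1r. Qed.

Definition quot_rel (x y : A) : bool := `[< I (x - y) >].

Lemma quot_rel_equiv : equiv_class_of quot_rel.
Proof.
have sym x y : I (x - y) -> I (y - x) by move/IN; rewrite opprB.
split=> [x|x y|y x z].
- by apply/asboolP; rewrite subrr.
- by apply/asboolP/asboolP; apply: sym.
- move=> /asboolP xy /asboolP yz; apply/asboolP.
  by rewrite -[x](subrK y) -addrA; apply: ID.
Qed.

Canonical quot_rel_canonical := EquivRelPack quot_rel_equiv.

Definition quot_alg := {eq_quot quot_rel}.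

HB.instance Definition _ := EqQuotient.on quot_alg.
HB.instance Definition _ := Choice.on quot_alg.

Definition quot_pi (x : A) : quot_alg := \pi_quot_alg x.

Lemma quot_piP x y : quot_pi x = quot_pi y <-> I (x - y).
Proof.
split=> [/eqmodP /asboolP //|xy]; apply/eqmodP.
exact/asboolP.
Qed.

Let rep (u : quot_alg) : A := repr u.
Let repK u : quot_pi (rep u) = u. Proof. exact: reprK. Qed.
Let repI x : I (rep (quot_pi x) - x).
Proof. by apply/quot_piP; rewrite repK. Qed.

Definition quot_zero : quot_alg := quot_pi 0.
Definition quot_one : quot_alg := quot_pi 1.
Definition quot_opp (u : quot_alg) : quot_alg := quot_pi (- repr u).
Definition quot_add (u v : quot_alg) : quot_alg := quot_pi (repr u + repr v).
Definition quot_mul (u v : quot_alg) : quot_alg := quot_pi (repr u * repr v).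

Let oppE x : quot_opp (quot_pi x) = quot_pi (- x).
Proof. by apply/quot_piP; rewrite -opprD; apply: IN; apply: repI. Qed.

Let addE x y : quot_add (quot_pi x) (quot_pi y) = quot_pi (x + y).
Proof. by apply/quot_piP; rewrite opprD addrACA; apply: ID; apply: repI. Qed.

Let mulE x y : quot_mul (quot_pi x) (quot_pi y) = quot_pi (x * y).
Proof.
apply/quot_piP; rewrite -/(rep _) -/(rep (quot_pi y)).
rewrite -[_ * _](subrK (rep (quot_pi x) * y)) -mulrBr -addrA -mulrBl.
by apply: ID; [apply: IMl|apply: IMr]; apply: repI.
Qed.

Let quot_ind (P : quot_alg -> Prop) : (forall x, P (quot_pi x)) -> forall u, P u.
Proof. by move=> H u; rewrite -[u]repK; apply: H. Qed.

Let qaddA : associative quot_add.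
Proof.
by elim/quot_ind=> x; elim/quot_ind=> y; elim/quot_ind=> z; rewrite !addE addrA.
Qed.
Let qaddC : commutative quot_add.
Proof. by elim/quot_ind=> x; elim/quot_ind=> y; rewrite !addE addrC. Qed.
Let qadd0 : left_id quot_zero quot_add.
Proof. by elim/quot_ind=> x; rewrite addE add0r. Qed.
Let qaddN : left_inverse quot_zero quot_opp quot_add.
Proof. by elim/quot_ind=> x; rewrite oppE addE addNr. Qed.

HB.instance Definition _ :=
  GRing.isZmodule.Build quot_alg qaddA qaddC qadd0 qaddN.

Let qpiD x y : quot_pi x + quot_pi y = quot_pi (x + y). Proof. exact: addE. Qed.

Let qmulA : associative quot_mul.
Proof.
by elim/quot_ind=> x; elim/quot_ind=> y; elim/quot_ind=> z; rewrite !mulE mulrA.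
Qed.
Let qmul1 : left_id quot_one quot_mul.
Proof. by elim/quot_ind=> x; rewrite mulE mul1r. Qed.
Let qmulr1 : right_id quot_one quot_mul.
Proof. by elim/quot_ind=> x; rewrite mulE mulr1. Qed.
Let qmulDl : left_distributive quot_mul +%R.
Proof.
elim/quot_ind=> x; elim/quot_ind=> y; elim/quot_ind=> z.
by rewrite qpiD !mulE qpiD mulrDl.
Qed.
Let qmulDr : right_distributive quot_mul +%R.
Proof.
elim/quot_ind=> x; elim/quot_ind=> y; elim/quot_ind=> z.
by rewrite qpiD !mulE qpiD mulrDr.
Qed.

HB.instance Definition _ := GRing.Zmodule_isPzRing.Build quot_alg
  qmulA qmul1 qmulr1 qmulDl qmulDr.

Lemma quot_pi_zmod_morphism : zmod_morphism quot_pi.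
Proof. by move=> x y; rewrite -[- quot_pi y]/(quot_opp _) oppE qpiD. Qed.
HB.instance Definition _ :=
  GRing.isZmodMorphism.Build A quot_alg quot_pi quot_pi_zmod_morphism.

Lemma quot_pi_monoid_morphism : monoid_morphism quot_pi.
Proof. by split=> // x y; rewrite -[RHS]/(quot_mul _ _) mulE. Qed.
HB.instance Definition _ :=
  GRing.isMonoidMorphism.Build A quot_alg quot_pi quot_pi_monoid_morphism.

Definition quot_in (c : k) : quot_alg := quot_pi (pz_in c).

Let quot_in_zmod_morphism : zmod_morphism quot_in.
Proof. by move=> c d; rewrite /quot_in !rmorphB. Qed.
Let quot_in_monoid_morphism : monoid_morphism quot_in.
Proof. by split=> [|c d]; rewrite /quot_in ?rmorph1 ?rmorphM. Qed.
Let quot_in_central c u : quot_in c * u = u * quot_in c.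
Proof. by elim/quot_ind: u => x; rewrite -!rmorphM pz_in_central. Qed.

HB.instance Definition _ := isPzAlgebra.Build k quot_alg
  quot_in_zmod_morphism quot_in_monoid_morphism quot_in_central.

Let qscaleA c d (u : quot_alg) : quot_in c * (quot_in d * u) = quot_in (c * d) * u.
Proof. by rewrite mulrA -quot_in_monoid_morphism.2. Qed.
Let qscale1 (u : quot_alg) : quot_in 1 * u = u.
Proof. by rewrite quot_in_monoid_morphism.1 mul1r. Qed.
Let qscaleDr : right_distributive (fun c (u : quot_alg) => quot_in c * u) +%R.
Proof. by move=> c u v; rewrite mulrDr. Qed.
Let qscaleDl (u : quot_alg) : {morph (fun c => quot_in c * u) : c d / c + d}.
Proof. by move=> c d; rewrite /quot_in !rmorphD mulrDl. Qed.

HB.instance Definition _ := GRing.Zmodule_isLmodule.Build k quot_alg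
  qscaleA qscale1 qscaleDr qscaleDl.

Lemma quot_scaleE (c : k) (u : quot_alg) : c *: u = pz_in c * u.
Proof. by []. Qed.

Lemma quot_pi_surj (u : quot_alg) : exists x, quot_pi x = u.
Proof. by exists (repr u); apply: repK. Qed.

End Quotient.

Definition trivial_alg (A : pzRingType) : Prop := forall x : A, x = 0.

Section MalgPzAlgebra.
Variables (k : fieldType) (K : monomType).

Let malgC_central (c : k) (x : {malg k[K]}) : c%:MP * x = x * c%:MP.
Proof.
rewrite [x]monalgE mulr_sumr mulr_suml; apply: eq_bigr => u _.
by rewrite !malgM_def !fgmulUU mul1m mulm1 mulrC.
Qed.

HB.instance Definition _ := isPzAlgebra.Build k {malg k[K]}
  (raddfB (@malgC K k)) (conj (rmorph1 (@malgC K k)) (rmorphM (@malgC K k)))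
  malgC_central.
End MalgPzAlgebra.

(* [{fmonom 'I_m}] is the free monoid on [m] letters, so [{malg k[_]}] over it
   is the free associative unital algebra.  An element of Z/mu is represented
   by an integer taken modulo [mu]; [mu = 0] gives the grading in Z. *)
Section SuperCommutative.
Variables (k : fieldType) (m : nat) (mu : int) (deg : 'I_m -> int).

Definition word_deg (w : {fmonom 'I_m}) : int :=
  \sum_(i <- (w : seq 'I_m)) deg i.

Definition free_homog (d : int) (f : {malg k[{fmonom 'I_m}]}) : Prop :=
  forall w, w \in msupp f -> (word_deg w = d %[mod mu])%Z.

(* Meaningful on Z/mu only when [mu] is even or [k] has characteristic two. *)
Definition koszul_sign (d : int) : k := (-1) ^+ absz d.

Definition supercomm_rel (x : {malg k[{fmonom 'I_m}]}) : Prop :=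
  exists (d e : int) (a b : {malg k[{fmonom 'I_m}]}),
    [/\ free_homog d a, free_homog e b
      & x = a * b - koszul_sign (d * e) *: (b * a)].

Definition sc_alg := quot_alg supercomm_rel.

HB.instance Definition _ := PzAlgebra.on sc_alg.
HB.instance Definition _ := GRing.Lmodule.on sc_alg.

Definition sc_of_free (f : {malg k[{fmonom 'I_m}]}) : sc_alg :=
  quot_pi supercomm_rel f.

HB.instance Definition _ :=
  GRing.isZmodMorphism.Build {malg k[{fmonom 'I_m}]} sc_alg sc_of_free
    (@quot_pi_zmod_morphism k _ supercomm_rel).
HB.instance Definition _ :=
  GRing.isMonoidMorphism.Build {malg k[{fmonom 'I_m}]} sc_alg sc_of_free
    (@quot_pi_monoid_morphism k _ supercomm_rel).

Lemma sc_of_free_scalable : scalable sc_of_free.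
Proof. by move=> c f; rewrite -mul_malgC rmorphM. Qed.
HB.instance Definition _ :=
  GRing.isScalable.Build k {malg k[{fmonom 'I_m}]} sc_alg *:%R sc_of_free
    sc_of_free_scalable.

Definition sc_mon (w : {fmonom 'I_m}) : sc_alg := sc_of_free << w >>.

Definition sc_gen (i : 'I_m) : sc_alg := sc_mon (fmu i).

Definition sc_homog (d : int) (x : sc_alg) : Prop :=
  exists2 f, free_homog d f & sc_of_free f = x.

(* Whenever [koszul_sign] is meaningful on Z/mu, the classes of the normal
   words form a [k]-basis of [sc_alg], so [appears] below refers to the
   coefficient of [w] in a unique expansion.  The normal words are the
   monomials of the super-commutative algebra, each written in one order and
   without those that vanish because of a repeated odd letter. *)
Definition normal_word (w : {fmonom 'I_m}) : Prop :=
  sorted (fun i j : 'I_m => (i <= j)%N) w /\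
  forall i, 2%N \notin [pchar k] -> odd (absz (deg i)) ->
    (count_mem i w <= 1)%N.

Definition appears (w : {fmonom 'I_m}) (x : sc_alg) : Prop :=
  exists f : {malg k[{fmonom 'I_m}]},
    [/\ sc_of_free f = x,
        forall v, v \in msupp f -> normal_word v
      & f@_w != 0].

End SuperCommutative.

Definition word_action (R : realType) (m : nat) (l : 'I_m -> R)
    (w : {fmonom 'I_m}) : R :=
  \sum_(i <- (w : seq 'I_m)) l i.

Record scDGA (k : fieldType) (R : realType) (mu : int) := ScDGA {
  ngens : nat;
  gdeg : 'I_ngens -> int;
  diff : {linear sc_alg k mu gdeg -> sc_alg k mu gdeg};
  diff_deg : forall (d : int) (x : sc_alg k mu gdeg),
    sc_homog d x -> sc_homog (d - 1) (diff x);
  diff_diff : forall x, diff (diff x) = 0;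
  diff_scalar : forall c : k, diff (pz_in c) = 0;
  diff_leibniz : forall v w : {fmonom 'I_ngens},
    diff (sc_mon k mu gdeg v * sc_mon k mu gdeg w) =
      diff (sc_mon k mu gdeg v) * sc_mon k mu gdeg w +
      koszul_sign k (word_deg gdeg v) *:
        (sc_mon k mu gdeg v * diff (sc_mon k mu gdeg w));
  action : 'I_ngens -> R;
  action_gt0 : forall i, 0 < action i;
  diff_action : forall (i : 'I_ngens) (w : {fmonom 'I_ngens}),
    appears w (diff (sc_gen k mu gdeg i)) -> word_action action w < action i
}.

Notation dga_alg D := (sc_alg _ _ (@gdeg _ _ _ D)).

Section CharacteristicAlgebra.
Variables (k : fieldType) (R : realType) (mu : int) (D : scDGA k R mu).

Definition acyclic : Prop :=
  forall x : dga_alg D, diff D x = 0 -> exists y, x = diff D y.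

Definition boundary (x : dga_alg D) : Prop := exists y, x = diff D y.

Definition char_alg : pzAlgType k := quot_alg boundary.

Definition char_homog (d : int) (z : char_alg) : Prop :=
  exists2 x : dga_alg D, sc_homog d x & quot_pi boundary x = z.

Definition char_odd (z : char_alg) : Prop :=
  exists2 d : int, odd (absz d) & char_homog d z.

Definition char_alg_even : pzAlgType k := quot_alg char_odd.

End CharacteristicAlgebra.

(* Main.v *)
(** In characteristic two, squares are cycles and
    [x^2 * (diff a)^2 = diff (x^2 * a * diff a)], so the elements whose square
    is a boundary form an ideal containing all boundaries.  If this ideal
    contains [1], then [1] is a boundary.

    In the other case, words with [p] odd letters span an ideal [O_p], with
    [O_p * O_q] inside [O_(p+q)] and [O_p = 0] once [p] exceeds the number of
    generators.  The elements congruent modulo [O_1] to [diff y] for some odd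
    [y] form an ideal containing all boundaries and all odd elements.  If it
    contains [1], then [1 = diff y + n] where [n] is a nilpotent even cycle, and
    [y * (1 + n + n^2 + ...)] has boundary [1]. *)
Require Import Defs.
From mathcomp Require Import all_boot all_order all_algebra.
From mathcomp Require Import finmap reals zify.
From mathcomp.multinomials Require Import monalg.

Set Implicit Arguments.
Unset Strict Implicit.
Unset Printing Implicit Defensive.

Import GRing.Theory.

Local Open Scope ring_scope.

(** * Identities in possibly zero rings *)

Lemma trivial_algP (A : pzRingType) : 1 = 0 :> A -> trivial_alg A.
Proof. by move=> one0 x; rewrite -[x]mul1r one0 mul0r. Qed.

Lemma sqr_add_char2 (A : pzRingType) (x y : A) :
  (forall z : A, z + z = 0) -> x * y = y * x ->
  (x + y) * (x + y) = x * x + y * y.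
Proof.
move=> addzz xy.
by rewrite mulrDl !mulrDr xy addrA -(addrA (x * x)) addzz addr0.
Qed.

Lemma sqr_sandwich (A : pzRingType) (a b x : A) : @commutative A A *%R ->
  (a * x * b) * (a * x * b) = (a * b) * (a * b) * (x * x).
Proof.
move=> C; have -> : a * x * b = a * b * x by rewrite -!mulrA (C x).
by move: (a * b) => c; rewrite -[LHS]mulrA (C x) !mulrA.
Qed.

(** The bracket subtracted is the Leibniz expansion of [d (a * y * b)] for even [a] and odd [y];
    what remains beyond [a * (x - dy) * b] keeps a factor [y]. *)
Lemma sandwich_sub (A : pzRingType) (a b x y da db dy : A) :
  a * x * b - (da * (y * b) + a * (dy * b - y * db)) =
    a * (x - dy) * b + (a * (y * db) - da * (y * b)).
Proof.
rewrite !(mulrBr, mulrBl) !mulrA [da * y * b + _]addrC.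
by rewrite opprD opprB [a * y * db - a * dy * b]addrC !addrA.
Qed.

Lemma nilpotent_geometric_sum (A : pzRingType) (x : A) (N : nat) :
  x ^+ N = 0 -> (1 - x) * \sum_(p < N) x ^+ p = 1.
Proof. by move=> xN; rewrite -opprB mulNr -subrX1 xN sub0r opprK. Qed.

(** * Linearity of unbundled functions *)

Section LinearMaps.
Variables (k : fieldType) (U V W : lmodType k).

Lemma linear_fun0 (f : U -> V) : linear f -> f 0 = 0.
Proof. by move=> /(_ (-1) 0 0); rewrite scaler0 addr0 scaleN1r addNr. Qed.

Lemma linear_funD (f : U -> V) : linear f -> {morph f : u v / u + v}.
Proof. by move=> lf u v; rewrite -[u in LHS]scale1r lf scale1r. Qed.

Lemma linear_funZ (f : U -> V) :
  linear f -> forall c u, f (c *: u) = c *: f u.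
Proof. by move=> lf c u; rewrite -[_ *: u]addr0 lf (linear_fun0 lf) addr0. Qed.

Lemma linear_comp_fun (f : V -> W) (g : U -> V) :
  linear f -> linear g -> linear (f \o g).
Proof. by move=> lf lg c u v; rewrite /= lg lf. Qed.

Lemma linear_add_fun (f g : U -> V) :
  linear f -> linear g -> linear (fun u => f u + g u).
Proof. by move=> lf lg c u v; rewrite lf lg scalerDr addrACA. Qed.

Lemma linear_scale_fun (s : k) : linear (fun u : U => s *: u).
Proof. by move=> c u v; rewrite scalerDr !scalerA mulrC. Qed.

End LinearMaps.

(** * Subspaces of the super-commutative algebra spanned by words *)

Section WordSpan.
Variables (k : fieldType) (m : nat) (mu : int) (deg : 'I_m -> int).
Local Notation A := (sc_alg k mu deg).
Local Notation mon := (sc_mon k mu deg).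
Implicit Types (P Q T : {fmonom 'I_m} -> Prop) (x y : A) (c : k).

Lemma sc_scalerAl c x y : c *: (x * y) = c *: x * y.
Proof. by rewrite !quot_scaleE mulrA. Qed.

Lemma sc_scalerAr c x y : c *: (x * y) = x * (c *: y).
Proof. by rewrite !quot_scaleE !mulrA pz_in_central. Qed.

Lemma sc_monM v w : mon (mmul v w) = mon v * mon w.
Proof. by rewrite /sc_mon -rmorphM /= malgM_def fgmulUU mulr1. Qed.

Lemma sc_mon_cat s1 s2 : mon (FMonom (s1 ++ s2)) = mon (FMonom s1) * mon (FMonom s2).
Proof. by rewrite -sc_monM; congr (mon _); apply/val_inj; rewrite /= fmM. Qed.

(** Only one representative has to be supported on [P]. The even part, the odd part and the ideals
    [O_p] are all of this form. *)
Definition wspan P x : Prop :=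
  exists2 f : {malg k[{fmonom 'I_m}]},
    (forall w, w \in msupp f -> P w) & sc_of_free mu deg f = x.

Lemma wspan_all x : wspan (fun=> True) x.
Proof. by have [f fx] := quot_pi_surj x; exists f. Qed.

Lemma wspanS P Q x : (forall w, P w -> Q w) -> wspan P x -> wspan Q x.
Proof. by move=> PQ [f fP fx]; exists f => // w /fP/PQ. Qed.

Lemma wspan0 P : wspan P 0.
Proof. by exists 0; [move=> w; rewrite msupp0|rewrite rmorph0]. Qed.

Lemma wspanD P x y : wspan P x -> wspan P y -> wspan P (x + y).
Proof.
move=> [f fP <-] [g gP <-]; exists (f + g); last by rewrite rmorphD.
by move=> w /(fsubsetP (msuppD_le _ _)); rewrite inE => /orP[/fP|/gP].
Qed.

Lemma wspanZ P c x : wspan P x -> wspan P (c *: x).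
Proof.
move=> [f fP <-]; exists (c *: f); last by rewrite linearZ.
by move=> w /(fsubsetP (msuppZ_le _ _)) /fP.
Qed.

Lemma wspanN P x : wspan P x -> wspan P (- x).
Proof. by rewrite -scaleN1r; apply: wspanZ. Qed.

Lemma wspan_mon P w : P w -> wspan P (mon w).
Proof. by exists << w >> => // v; rewrite msuppU1 inE => /eqP->. Qed.

Lemma wspanM P Q T x y :
  (forall v w, P v -> Q w -> T (mmul v w)) ->
  wspan P x -> wspan Q y -> wspan T (x * y).
Proof.
move=> PQT [f fP <-] [g gQ <-]; exists (f * g); last by rewrite rmorphM.
by move=> w /msuppM_le[v1 [v2 [/fP Pv1 /gQ Qv2 ->]]]; apply: PQT.
Qed.

Lemma wspan_ind P (Q : A -> Prop) :
  Q 0 -> (forall x y, Q x -> Q y -> Q (x + y)) ->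
  (forall c w, P w -> Q (c *: mon w)) ->
  forall x, wspan P x -> Q x.
Proof.
move=> Q0 QD QZ x [f fP <-]; rewrite [f]monalgE rmorph_sum big_seq.
elim/big_ind: _ => // w /fP Pw /=.
have -> : << f@_w *g w >> = f@_w *: << w >> :> {malg k[{fmonom 'I_m}]}.
  by rewrite -mul_malgC malgM_def fgmulUU mulr1 mul1m.
by rewrite linearZ; apply: QZ.
Qed.

Lemma wspan_linear_ext P (f g : A -> A) :
  linear f -> linear g -> (forall w, P w -> f (mon w) = g (mon w)) ->
  forall x, wspan P x -> f x = g x.
Proof.
move=> lf lg fg; apply: wspan_ind => [|x y fx fy|c w /fg fw].
- by rewrite (linear_fun0 lf) (linear_fun0 lg).
- by rewrite (linear_funD lf) (linear_funD lg) fx fy.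
- have fc := linear_funZ lf c (mon w).
  exact: etrans fc (etrans (congr1 _ fw) (esym (linear_funZ lg c _))).
Qed.

Lemma linear_mulr_fun y : linear (fun x : A => x * y).
Proof. by move=> c u v; rewrite mulrDl sc_scalerAl. Qed.

Lemma linear_mull_fun y : linear (fun x : A => y * x).
Proof. by move=> c u v; rewrite mulrDr sc_scalerAr. Qed.

(** A single word is homogeneous of its own degree, so this is an instance of the defining
    relations. *)
Lemma sc_monC v w :
  mon v * mon w =
    koszul_sign k (word_deg deg v * word_deg deg w) *: (mon w * mon v).
Proof.
have homog u : free_homog mu deg (word_deg deg u) (<< u >> : {malg k[{fmonom 'I_m}]}).
  by move=> t; rewrite msuppU1 inE => /eqP->.
rewrite /sc_mon -!rmorphM -linearZ; apply/quot_piP.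
apply: ideal_gen_sub.
by exists (word_deg deg v), (word_deg deg w), << v >>, << w >>.
Qed.

(** * Odd letters: parity, vanishing and nilpotence *)

Definition odd_word (w : {fmonom 'I_m}) : bool := odd (absz (word_deg deg w)).

(** A count rather than a parity: it adds under products and can be compared with the number of
    generators. *)
Definition n_odd (w : {fmonom 'I_m}) : nat :=
  count (fun i => odd (absz (deg i))) w.

Lemma n_oddM v w : n_odd (mmul v w) = (n_odd v + n_odd w)%N.
Proof. by rewrite /n_odd fmM count_cat. Qed.

Lemma odd_wordE w : odd_word w = odd (n_odd w).
Proof.
case: w => s; rewrite /odd_word /word_deg /n_odd /=.
elim: s => [|i s IHs]; first by rewrite big_nil.
by rewrite big_cons /= oddD -IHs; lia.
Qed.

Lemma odd_wordM v w : odd_word (mmul v w) = odd_word v (+) odd_word w.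
Proof. by rewrite !odd_wordE n_oddM oddD. Qed.

Lemma koszul_sign_word w : koszul_sign k (word_deg deg w) = (-1) ^+ odd_word w.
Proof. by rewrite /koszul_sign signr_odd. Qed.

Section OddLetters.
Hypothesis char_neq2 : 2%N \notin [pchar k].

(** Exchanging the two equal odd letters gives [u = - u], and 2 is invertible. *)
Lemma odd_letter_sqr0 i :
  odd (absz (deg i)) -> mon (FMonom [:: i]) * mon (FMonom [:: i]) = 0.
Proof.
move=> odd_i; set u := mon _ * _.
have uN : u = - u.
  rewrite {1}/u sc_monC /word_deg /= big_seq1 /koszul_sign abszM -signr_odd.
  by rewrite oddM odd_i scaleN1r.
have two_neq0 : (2 : k) != 0 by apply: contra char_neq2 => two0; rewrite inE /=.
rewrite -[u]scale1r -(mulVf two_neq0) -scalerA scaler_nat [u *+ 2]mulr2n.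
by rewrite [X in X + u]uN addNr scaler0.
Qed.

Lemma odd_letter_sandwich0 i w :
  odd (absz (deg i)) -> mon (FMonom [:: i]) * (mon w * mon (FMonom [:: i])) = 0.
Proof.
move=> /odd_letter_sqr0; have := sc_monC (FMonom [:: i]) w.
move: (mon (FMonom [:: i])) (mon w) => a b ab aa.
by rewrite mulrA ab -sc_scalerAl -mulrA aa mulr0 scaler0.
Qed.

(** At the first odd letter that recurs, the two copies enclose a word. Commuting one copy past it,
    up to sign, produces the square of an odd letter. *)
Lemma repeated_odd_letter s :
  ~~ uniq (filter (fun i => odd (absz (deg i))) s) -> mon (FMonom s) = 0.
Proof.
elim: s => [//|i s IHs] /=; rewrite (sc_mon_cat [:: i] s).
case: ifP => [odd_i|_ /IHs->]; last by rewrite mulr0.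
rewrite /= negb_and negbK mem_filter odd_i /= => /orP[|/IHs->]; last first.
  by rewrite mulr0.
case/splitPr => s1 s2; rewrite (sc_mon_cat s1 (i :: s2)) (sc_mon_cat [:: i] s2).
have := odd_letter_sandwich0 (FMonom s1) odd_i.
move: (mon _) (mon _) (mon _) => a b c abc.
by rewrite [b * _]mulrA mulrA abc mul0r.
Qed.

(** Pigeonhole: more than [m] odd letters among [m] generators force a repetition. *)
Lemma n_odd_wspan_eq0 x : wspan (fun w => (m < n_odd w)%N) x -> x = 0.
Proof.
move: x; apply: wspan_ind => [//|x y -> ->|c [s]]; first by rewrite addr0.
rewrite /n_odd -size_filter /= => m_lt.
rewrite repeated_odd_letter ?scaler0 //; apply: contraL m_lt => /card_uniqP <-.
by rewrite -leqNgt (leq_trans (max_card _)) ?card_ord.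
Qed.

Lemma n_odd_nilpotent x :
  wspan (fun w => (0 < n_odd w)%N) x -> x ^+ m.+1 = 0.
Proof.
move=> Ox; apply: n_odd_wspan_eq0.
(* Each factor contributes at least one odd letter; [p = m.+1] exceeds the number of generators. *)
suff: forall p, wspan (fun w => (p <= n_odd w)%N) (x ^+ p) by apply.
elim=> [|p IHp]; first exact: wspanS (wspan_all _).
rewrite exprS; apply: wspanM Ox IHp => v w.
by rewrite n_oddM; apply: leq_add.
Qed.

End OddLetters.

Lemma wspan_parity_split x :
  exists x0 x1, [/\ wspan (fun w => ~~ odd_word w) x0,
    wspan odd_word x1 & x = x0 + x1].
Proof.
move: (wspan_all x); move: x; apply: wspan_ind => [|x y|c w _].
- by exists 0, 0; split; [exact: wspan0..|rewrite addr0].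
- move=> [x0 [x1 [ex ox ->]]] [y0 [y1 [ey oy ->]]].
  by exists (x0 + y0), (x1 + y1); split; [exact: wspanD..|rewrite addrACA].
- case: (boolP (odd_word w)) => [ow|ew].
    exists 0, (c *: mon w); split; [exact: wspan0| |by rewrite add0r].
    exact/wspanZ/wspan_mon.
  exists (c *: mon w), 0; split; [|exact: wspan0|by rewrite addr0].
  exact/wspanZ/wspan_mon.
Qed.

End WordSpan.

(** * The Leibniz rule and triviality of the quotients *)

Section DGA.
Variables (k : fieldType) (R : realType) (mu : int) (D : scDGA k R mu).
Local Notation A := (sc_alg k mu (@gdeg k R mu D)).
Local Notation d := (diff D).
Local Notation mon := (sc_mon k mu (@gdeg _ _ _ D)).
Implicit Types x y z : A.

Lemma diff0 : d 0 = 0.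
Proof. exact: linear0. Qed.

Lemma diffD x y : d (x + y) = d x + d y.
Proof. exact: linearD. Qed.

Lemma diffB x y : d (x - y) = d x - d y.
Proof. exact: linearB. Qed.

Lemma diff1 : d 1 = 0.
Proof. by rewrite -[1](rmorph1 (@pz_in k A)); apply: diff_scalar. Qed.

(** The rule is given on words. Where the sign is a constant [s], both sides are linear in [x] and
    in [y], so it extends to the whole span. *)
Lemma leibniz_wspan (P : {fmonom 'I_(ngens D)} -> Prop) (s : k) x y :
  (forall w, P w -> koszul_sign k (word_deg (@gdeg _ _ _ D) w) = s) ->
  wspan P x -> d (x * y) = d x * y + s *: (x * d y).
Proof.
move=> Ps Px.
have lind : linear d by move=> c u v; exact: linearP.
pose lins := @linear_scale_fun k A s.
apply: (wspan_linear_ext (f := fun x => d (x * y))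
  (g := fun x => d x * y + s *: (x * d y)) _ _ _ Px).
- exact: (linear_comp_fun lind (@linear_mulr_fun k _ mu _ y)).
- apply: linear_add_fun.
    exact: (linear_comp_fun (@linear_mulr_fun k _ mu _ y) lind).
  exact: (linear_comp_fun lins (@linear_mulr_fun k _ mu _ (d y))).
move=> v Pv; apply: (wspan_linear_ext (f := fun y => d (mon v * y))
  (g := fun y => d (mon v) * y + s *: (mon v * d y)) _ _ _ (wspan_all y)).
- exact: (linear_comp_fun lind (@linear_mull_fun k _ mu _ (mon v))).
- apply: linear_add_fun; first exact: linear_mull_fun.
  apply: (linear_comp_fun lins).
  exact: (linear_comp_fun (@linear_mull_fun k _ mu _ (mon v)) lind).
by move=> w _; rewrite diff_leibniz (Ps v Pv).
Qed.

(** The unit is a cycle, hence a boundary, so the ideal of boundaries is everything. *)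
Lemma acyclic_char_alg_trivial : acyclic D -> trivial_alg (char_alg D).
Proof.
move=> /(_ 1 diff1) B1 z.
apply: trivial_algP; have : quot_pi (@boundary k R mu D) 1 = quot_pi _ 0.
  by apply/quot_piP; rewrite subr0; apply: ideal_gen_sub.
by rewrite rmorph1 rmorph0.
Qed.

Lemma char_alg_even_trivial :
  trivial_alg (char_alg D) -> trivial_alg (char_alg_even D).
Proof.
move=> triv; apply: trivial_algP.
by rewrite -(rmorph1 (quot_pi (@char_odd k R mu D))) (triv 1) rmorph0.
Qed.

(** The ideal generated by the boundaries lies in every ideal containing them. This makes triviality
    usable through a well-chosen [I]. *)
Lemma char_alg_trivial_ideal (I : A -> Prop) :
  trivial_alg (char_alg D) -> two_sided_ideal I -> (forall z, I (d z)) -> I 1.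
Proof.
move=> triv HI Id.
have /quot_piP : quot_pi (@boundary k R mu D) 1 = quot_pi (@boundary k R mu D) 0.
  by rewrite (triv (quot_pi _ 1)) rmorph0.
by rewrite subr0; apply => // _ [z ->].
Qed.

Lemma char_alg_even_trivial_ideal (I : A -> Prop) :
  trivial_alg (char_alg_even D) -> two_sided_ideal I -> (forall z, I (d z)) ->
  (forall e x, odd (absz e) -> sc_homog e x -> I x) -> I 1.
Proof.
move=> triv [I0 ID IM] Id Iodd.
have /quot_piP : quot_pi (@char_odd k R mu D) 1 = quot_pi (@char_odd k R mu D) 0.
  by rewrite (triv (quot_pi _ 1)) rmorph0.
rewrite subr0 => odd1.
(* The second quotient is taken over [char_alg D], so [I] is first pushed forward to an ideal [J]
   there. *)
pose J (z : char_alg D) := exists2 x : A, I x & quot_pi (@boundary k R mu D) x = z.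
have [||x Ix /esym/quot_piP bx] := odd1 J.
- split=> [|_ _ [x Ix <-] [y Iy <-]|a b _ [x Ix <-]].
  + by exists 0; rewrite ?rmorph0.
  + by exists (x + y); [exact: ID|rewrite rmorphD].
  + have [a' <-] := quot_pi_surj a; have [b' <-] := quot_pi_surj b.
    by exists (a' * x * b'); [exact: IM|rewrite !rmorphM].
- by move=> _ [e oe [x hx <-]]; exists x => //; apply: Iodd hx.
(* [1] and [x] have the same class, so they differ by an element of the ideal of boundaries, which
   [I] contains. *)
have I1x : I (1 - x) by apply: bx => // _ [y ->].
by have := ID _ _ I1x Ix; rewrite subrK.
Qed.

End DGA.

(** * Characteristic two *)

Section CharTwo.
Variables (k : fieldType) (R : realType) (mu : int) (D : scDGA k R mu).
Hypothesis char2 : 2%N \in [pchar k].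
Local Notation A := (sc_alg k mu (@gdeg k R mu D)).
Local Notation d := (diff D).
Implicit Types x y z : A.

Lemma koszul_sign_char2 e : koszul_sign k e = 1.
Proof. by rewrite /koszul_sign oppr_pchar2 // expr1n. Qed.

Lemma char2_addrr x : x + x = 0.
Proof. by rewrite -mulr2n -scaler_nat (pcharf0 char2) scale0r. Qed.

Lemma char2_mulrC x y : x * y = y * x.
Proof.
apply: (wspan_linear_ext (f := fun x => x * y) (g := fun x => y * x)
  _ _ _ (wspan_all x)) => [||v _].
- exact: linear_mulr_fun.
- exact: linear_mull_fun.
apply: (wspan_linear_ext (f := fun y => _ * y) (g := fun y => y * _)
  _ _ _ (wspan_all y)) => [||w _].
- exact: linear_mull_fun.
- exact: linear_mulr_fun.
by rewrite sc_monC koszul_sign_char2 scale1r.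
Qed.

Lemma char2_leibniz x y : d (x * y) = d x * y + x * d y.
Proof.
rewrite (leibniz_wspan y (s := 1) _ (wspan_all x)) ?scale1r // => w _.
exact: koszul_sign_char2.
Qed.

Lemma char2_diff_sqr x : d (x * x) = 0.
Proof. by rewrite char2_leibniz [x * d x]char2_mulrC char2_addrr. Qed.

Lemma char2_acyclic : trivial_alg (char_alg D) -> acyclic D.
Proof.
move=> triv.
have [||y] := @char_alg_trivial_ideal k R mu D
    (fun x => exists y, x * x = d y) triv; last 1 first.
(* Once [1 = d y], any cycle [x] is the boundary of [y * x]. *)
- rewrite mulr1 => dy x dx; exists (y * x).
  by rewrite char2_leibniz dx mulr0 addr0 -dy mul1r.
- split=> [|x x' [y dy] [y' dy']|a b x [y dy]].
  + by exists 0; rewrite mulr0 diff0.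
  + exists (y + y'); rewrite diffD -dy -dy'.
    exact: sqr_add_char2 char2_addrr (char2_mulrC x x').
  (* The square of [a * b] is a cycle, so it passes through [d]. *)
  + exists ((a * b) * (a * b) * y).
    rewrite char2_leibniz char2_diff_sqr mul0r add0r -dy.
    exact: sqr_sandwich char2_mulrC.
- by move=> z; exists (z * d z); rewrite char2_leibniz diff_diff mulr0 addr0.
Qed.

End CharTwo.

(** * Characteristic different from two, grading in Z/2 *)

Section OddCharacteristic.
Variables (k : fieldType) (R : realType) (D : scDGA k R 2).
Hypothesis char_neq2 : 2%N \notin [pchar k].
Local Notation A := (sc_alg k 2 (@gdeg k R 2 D)).
Local Notation d := (diff D).
Local Notation odd_word := (odd_word (@gdeg _ _ _ D)).
Local Notation evenA := (wspan (fun w => ~~ odd_word w)).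
Local Notation oddA := (wspan odd_word).
Local Notation O1 := (wspan (fun w => 0 < n_odd (@gdeg _ _ _ D) w)%N).
Implicit Types x y z : A.

Lemma sc_homog_odd e x : odd (absz e) -> sc_homog e x -> oddA x.
Proof.
move=> oe [f hf <-]; exists f => // w /hf; rewrite /odd_word.
by move: (word_deg _ w) => t; lia.
Qed.

Lemma sc_homog_even e x : ~~ odd (absz e) -> sc_homog e x -> evenA x.
Proof.
move=> oe [f hf <-]; exists f => // w /hf; rewrite /odd_word.
by move: (word_deg _ w) => t; lia.
Qed.

Lemma diff_even x : evenA x -> oddA (d x).
Proof.
(* Modulo 2, even elements are homogeneous of degree 0, and [0 - 1] is odd. *)
move=> [f ef fx]; apply: (@sc_homog_odd (0 - 1)) => //; apply: diff_deg.
exists f => // w /ef; rewrite /odd_word.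
by move: (word_deg _ w) => t; lia.
Qed.

Lemma diff_odd x : oddA x -> evenA (d x).
Proof.
move=> [f ef fx]; apply: (@sc_homog_even (1 - 1)) => //; apply: diff_deg.
exists f => // w /ef; rewrite /odd_word.
by move: (word_deg _ w) => t; lia.
Qed.

Lemma leibniz_even x y : evenA x -> d (x * y) = d x * y + x * d y.
Proof.
move=> ex; rewrite (leibniz_wspan y (s := 1) _ ex) ?scale1r // => w.
by rewrite koszul_sign_word => /negbTE->.
Qed.

Lemma leibniz_odd x y : oddA x -> d (x * y) = d x * y - x * d y.
Proof.
move=> ox; rewrite (leibniz_wspan y (s := -1) _ ox) ?scaleN1r // => w.
by rewrite koszul_sign_word => ->.
Qed.

Lemma oddA_O1 x : oddA x -> O1 x.
Proof.
apply: wspanS => w; rewrite odd_wordE.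
by case: (n_odd _ w).
Qed.

Lemma O1Ml x y : O1 y -> O1 (x * y).
Proof.
apply: wspanM (wspan_all x) => v w _ w0.
by rewrite n_oddM addn_gt0 w0 orbT.
Qed.

Lemma O1Mr x y : O1 x -> O1 (x * y).
Proof.
move=> Ox; apply: wspanM Ox (wspan_all y) => v w v0 _.
by rewrite n_oddM addn_gt0 v0.
Qed.

Lemma oddA_sandwich a y b : evenA a -> oddA y -> evenA b -> oddA (a * y * b).
Proof.
move=> ea oy eb; apply: (wspanM (P := odd_word)) eb => [v w|].
  by rewrite odd_wordM => -> /negbTE->.
apply: wspanM ea oy => v w.
by rewrite odd_wordM => /negbTE-> ->.
Qed.

(** Oddness of [y] puts every product containing [y] in [O1], which absorbs the Leibniz error terms,
    and makes [d y] even. *)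
Definition odd_boundary_mod x : Prop := exists2 y, oddA y & O1 (x - d y).

Lemma odd_boundary_mod_O1 x : O1 x -> odd_boundary_mod x.
Proof. by exists 0; [exact: wspan0|rewrite diff0 subr0]. Qed.

Lemma odd_boundary_modD x x' :
  odd_boundary_mod x -> odd_boundary_mod x' -> odd_boundary_mod (x + x').
Proof.
move=> [y oy Oy] [y' oy' Oy']; exists (y + y'); first exact: wspanD.
by rewrite diffD opprD addrACA; apply: wspanD.
Qed.

(** The odd part of [z] is the witness: the boundary of the even part is odd, hence in [O1]. *)
Lemma odd_boundary_mod_diff z : odd_boundary_mod (d z).
Proof.
have [z0 [z1 [ez oz ->]]] := wspan_parity_split z.
by exists z1 => //; rewrite diffD addrK; apply/oddA_O1/diff_even.
Qed.

Lemma odd_boundary_mod_ideal : two_sided_ideal odd_boundary_mod.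
Proof.
split=> [|x x'|a b x [y oy Oy]].
- exact/odd_boundary_mod_O1/wspan0.
- exact: odd_boundary_modD.
have [a0 [a1 [ea oa ->]]] := wspan_parity_split a.
have [b0 [b1 [eb ob ->]]] := wspan_parity_split b.
(* Apart from [a0 * x * b0], every summand has an odd factor [a1] or [b1] and lies in [O1]. *)
rewrite mulrDr !mulrDl -addrA; apply: odd_boundary_modD; last first.
  apply: odd_boundary_mod_O1; apply: wspanD.
    by do 2 apply: O1Mr; apply: oddA_O1.
  by apply: wspanD; apply: O1Ml; apply: oddA_O1.
exists (a0 * y * b0); first exact: oddA_sandwich.
have -> : d (a0 * y * b0) = d a0 * (y * b0) + a0 * (d y * b0 - y * d b0).
  by rewrite -(mulrA a0 y b0) (leibniz_even (y * b0) ea) (leibniz_odd b0 oy).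
rewrite sandwich_sub.
apply: wspanD; first by apply/O1Mr/O1Ml.
(* Both error terms contain the odd factor [y]. *)
by apply: wspanD; [|apply: wspanN]; apply/O1Ml/O1Mr/oddA_O1.
Qed.

Lemma odd_boundary_mod1_acyclic : odd_boundary_mod 1 -> acyclic D.
Proof.
move=> [y oy]; set n := 1 - d y => On x dx.
(* Since [d y] is an even cycle, multiplication by [n] preserves cycles. *)
have dn z : d z = 0 -> d (n * z) = 0.
  move=> dz; have dyz : d (d y * z) = 0.
    by rewrite (leibniz_even z (diff_odd oy)) diff_diff dz mul0r mulr0 addr0.
  by rewrite /n mulrBl mul1r diffB dz dyz subr0.
have dnX p : d (n ^+ p * x) = 0.
  elim: p => [|p IHp]; first by rewrite expr0 mul1r.
  by rewrite exprS -(mulrA n); apply: dn.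
(* The terminating geometric series, inverse to [1 - n = d y]: [n] lies in [O1], so its power
   [(ngens D).+1] vanishes. *)
pose u := \sum_(p < (ngens D).+1) n ^+ p.
have nu : d y * u = 1.
  have -> : d y = 1 - n by rewrite /n subKr.
  exact/nilpotent_geometric_sum/n_odd_nilpotent.
(* As [u * x] is a cycle, only [d y * u * x = x] survives. *)
exists (y * (u * x)); rewrite (leibniz_odd _ oy) mulrA nu mul1r.
have -> : d (u * x) = 0; last by rewrite mulr0 subr0.
rewrite mulr_suml raddf_sum; apply: big1 => p _; exact: dnX.
Qed.

Lemma char_alg_even_trivial_acyclic :
  trivial_alg (char_alg_even D) -> acyclic D.
Proof.
move=> triv; apply: odd_boundary_mod1_acyclic.
apply: char_alg_even_trivial_ideal triv odd_boundary_mod_ideal _ _.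
  exact: odd_boundary_mod_diff.
by move=> e x oe hx; apply/odd_boundary_mod_O1/oddA_O1/sc_homog_odd/hx.
Qed.

End OddCharacteristic.

Theorem proposition1p3 (k : fieldType) (R : realType) (mu : int)
    (D : scDGA k R mu) :
  (((2%N \notin [pchar k] /\ mu = 2) \/ 2%N \in [pchar k]) ->
     (trivial_alg (char_alg D) <-> acyclic D)) /\
  ((2%N \notin [pchar k] /\ mu = 2) ->
     (trivial_alg (char_alg_even D) <-> acyclic D)).
Proof.
split=> [[[char_neq2 mu2]|char2]|[char_neq2 mu2]].
(* Triviality passes to the further quotient by odd elements, whose triviality already implies
   acyclicity. *)
- subst mu; split=> [/char_alg_even_trivial|]; last exact: acyclic_char_alg_trivial.
  exact: char_alg_even_trivial_acyclic.
- by split; [exact: char2_acyclic|exact: acyclic_char_alg_trivial].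
- subst mu; split; first exact: char_alg_even_trivial_acyclic.
  by move=> /acyclic_char_alg_trivial/char_alg_even_trivial.
Qed.
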